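(* Let $n \ge 1$ and let $\Delta$ be a simplicial complex on $[n] = \{1,\dots,n\}$. Then Janet's algorithm gives recursively a partition of $\Delta$; that is, the finite collection $\mathcal{P}_n(\Delta)$ of pairs $(F,G)$ produced by Janet's algorithm (as described in the context) consists of pairs of faces $F \subseteq G$ of $\Delta$, and $$\Delta = \bigsqcup_{(F,G) \in \mathcal{P}_n(\Delta)} [F,G]$$ is a disjoint union of intervals.
   Context: A simplicial complex on $[n]$ is a family of subsets of $[n]$ closed under taking subsets; not every $\{i\}$, $i \in [n]$, is required to be a face, and the empty family is allowed. For faces $F \subseteq G$ of $\Delta$, the interval $[F,G]$ is $\{H \in \Delta : F \subseteq H \subseteq G\}$. A partition of $\Delta$ is a presentation of $\Delta$ as a disjoint union of intervals (the empty union if $\Delta$ is the empty family). Janet's algorithm for simplicial complexes. The order of the vertices is fixed. The algorithm assigns to each simplicial complex $\Delta$ on $[n]$ a finite collection $\mathcal{P}_n(\Delta)$ of pairs $(F,G)$, standing for the intervals $[F,G]$, recursively on $n$. For $n = 1$: $\mathcal{P}_1(\{\emptyset,\{1\}\}) = \{(\emptyset,\{1\})\}$, $\mathcal{P}_1(\{\emptyset\}) = \{(\emptyset,\emptyset)\}$, and the empty family gets the empty collection. For $n \ge 2$: let $\Delta_{[n-1]}$ be the set of all subsets of $[n-1]$, i.e. the interval $[\emptyset, \{1,\dots,n-1\}]$, and put $$\Delta_0 = \Delta \cap \Delta_{[n-1]} = \{F \in \Delta : n \notin F\}, \qquad \Delta_1 = \{F \subseteq [n-1] : F \cup \{n\}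 \in \Delta\}.$$ These are simplicial complexes on $[n-1]$. For $F \subseteq [n-1]$ write $nF = F \cup \{n\}$. With the recursively computed collections $\mathcal{P}_{n-1}(\Delta_0)$ and $\mathcal{P}_{n-1}(\Delta_1)$, define: (C1) if $\Delta_0 \neq \Delta_1$ and $\Delta_0 \neq \Delta_{[n-1]}$: $$\mathcal{P}_n(\Delta) = \mathcal{P}_{n-1}(\Delta_0) \cup \{(nF, nG) : (F,G) \in \mathcal{P}_{n-1}(\Delta_1)\};$$ (C2) if $\Delta_0 = \Delta_1$: $$\mathcal{P}_n(\Delta) = \{(F, nG) : (F,G) \in \mathcal{P}_{n-1}(\Delta_0)\};$$ (C3) if $\Delta_0 = \Delta_{[n-1]}$ and $\Delta_1 \ne \Delta_0$: $$\mathcal{P}_n(\Delta) = \{(\emptyset, \{1,\dots,n-1\})\} \cup \{(nF, nG) : (F,G) \in \mathcal{P}_{n-1}(\Delta_1)\}.$$ *)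

(* Defs.v *)
From mathcomp Require Import all_boot.

Set Implicit Arguments.
Unset Strict Implicit.
Unset Printing Implicit Defensive.

(* The vertex i of [n] = {1, ..., n} is the ordinal of value i - 1 in 'I_n. *)

Definition simplicial_complex (n : nat) (D : {set {set 'I_n}}) : Prop :=
  forall F G : {set 'I_n}, G \in D -> F \subset G -> F \in D.

Definition interval (n : nat) (D : {set {set 'I_n}}) (F G : {set 'I_n}) :
    {set {set 'I_n}} :=
  [set H in D | (F \subset H) && (H \subset G)].

(* Disjointness is required of the intervals of distinct pairs, not merely of
   distinct intervals. *)
Definition interval_partition (n : nat) (D : {set {set 'I_n}})
    (P : {set {set 'I_n} * {set 'I_n}}) : Prop :=
  [/\ forall F G, (F, G) \in P -> [/\ F \in D, G \in D & F \subset G],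
      D = \bigcup_(p in P) interval D p.1 p.2
    & forall p q, p \in P -> q \in P -> p != q ->
        [disjoint interval D p.1 p.2 & interval D q.1 q.2]].

Section JanetStep.

Variable n : nat.

Definition emb (F : {set 'I_n}) : {set 'I_n.+1} :=
  [set widen_ord (leqnSn n) i | i in F].

Definition add_last (F : {set 'I_n}) : {set 'I_n.+1} := ord_max |: emb F.

Definition delta0 (D : {set {set 'I_n.+1}}) : {set {set 'I_n}} :=
  [set F | emb F \in D].

Definition delta1 (D : {set {set 'I_n.+1}}) : {set {set 'I_n}} :=
  [set F | add_last F \in D].

(* The order of the tests encodes the side conditions: the case of a full
   delta0 is only reached when delta0 <> delta1. *)
Definition janet_step
    (rec : {set {set 'I_n}} -> {set {set 'I_n} * {set 'I_n}})
    (D : {set {set 'I_n.+1}}) : {set {set 'I_n.+1} * {set 'I_n.+1}} :=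
  if delta0 D == delta1 D then
    [set (emb p.1, add_last p.2) | p in rec (delta0 D)]
  else if delta0 D == [set: {set 'I_n}] then
    (set0, emb [set: 'I_n])
      |: [set (add_last p.1, add_last p.2) | p in rec (delta1 D)]
  else
    [set (emb p.1, emb p.2) | p in rec (delta0 D)]
      :|: [set (add_last p.1, add_last p.2) | p in rec (delta1 D)].

End JanetStep.

(* The last value only matters on the empty family: [set [set ord0]] is not a
   simplicial complex. *)
Definition janet_base (D : {set {set 'I_1}}) : {set {set 'I_1} * {set 'I_1}} :=
  if D == [set set0; [set ord0]] then [set (set0, [set ord0])]
  else if D == [set set0] then [set (set0, set0)]
  else set0.

Definition janet_succ (m : nat) :
    ({set {set 'I_m}} -> {set {set 'I_m} * {set 'I_m}}) ->
    {set {set 'I_m.+1}} -> {set {set 'I_m.+1} * {set 'I_m.+1}} :=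
  match m with
  | 0 => fun _ => janet_base
  | k.+1 => @janet_step k.+1
  end.

(* The recursion starts at n = 1; the value at n = 0 is a dummy. *)
Fixpoint janet (n : nat) :
    {set {set 'I_n}} -> {set {set 'I_n} * {set 'I_n}} :=
  match n with
  | 0 => fun _ => set0
  | m.+1 => janet_succ (@janet m)
  end.

(* Main.v *)
Require Import Defs.
From mathcomp Require Import all_boot.

Set Implicit Arguments.
Unset Strict Implicit.
Unset Printing Implicit Defensive.

(* The subsets of [n] are the sets [emb F] and [add_last F] for F a subset of
   [n-1], and the only inclusions among them are those induced by inclusions in
   [n-1], an [add_last F] never lying below an [emb G].  Hence partitions of
   Delta_0 and Delta_1 lift to a partition of Delta; when Delta_0 = Delta_1 the
   two lifts of each interval glue into a single one.  Case (C3) is the lift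
   that uses the one-interval partition of a full Delta_0. *)

(** No family [D] appears, so that the condition transfers between [n-1] and [n] by inclusions
    alone. *)
Definition in_span (n : nat) (p : {set 'I_n} * {set 'I_n}) (H : {set 'I_n}) :=
  (p.1 \subset H) && (H \subset p.2).

(** Downward closure makes every set below [p.2] a face, so intervals in [D] reduce to [in_span],
    and disjointness becomes uniqueness of the pair spanning a given set. *)
Lemma interval_partitionP (n : nat) (D : {set {set 'I_n}})
    (P : {set {set 'I_n} * {set 'I_n}}) (hD : simplicial_complex D) :
  interval_partition D P <->
  [/\ forall p, p \in P -> p.2 \in D /\ p.1 \subset p.2,
      forall H, H \in D -> exists2 p, p \in P & in_span p H
    & forall p q H, p \in P -> q \in P -> in_span p H -> in_span q H -> p = q].
Proof.
split=> -[faceP coverP disjP].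
  have faceP' p : p \in P -> p.2 \in D /\ p.1 \subset p.2.
    by case: p => F G /faceP[].
  split=> // [H | p q H pP qP pH qH].
    rewrite {1}coverP => /bigcupP[p pP].
    by rewrite inE => /andP[_ pH]; exists p.
  have HD : H \in D.
    by case/andP: pH => _; apply: hD; case: (faceP' p pP).
  apply/eqP; apply: contraT => /(disjP p q pP qP)/pred0P/(_ H).
  by rewrite !inE HD -!/(in_span _ _) pH qH.
split=> [F G /faceP[GD FG] | | p q pP qP /eqP npq].
- by split=> //; apply: hD FG.
- apply/setP=> H; apply/idP/bigcupP => [HD | [p _]].
    by have [p pP pH] := coverP H HD; exists p => //; rewrite inE HD.
  by rewrite inE => /andP[].
- apply/pred0P=> H /=; apply/negP; rewrite !inE.
  by case/andP=> /andP[_ pH] /andP[_ qH]; apply/npq/(disjP p q H).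
Qed.

Section Lifting.

Variable n : nat.
Implicit Types (F G : {set 'I_n}) (D : {set {set 'I_n.+1}}).

Lemma ord_maxVwiden (i : 'I_n.+1) :
  i = ord_max \/ exists j : 'I_n, i = widen_ord (leqnSn n) j.
Proof.
have := ltn_ord i; rewrite ltnS leq_eqVlt => /orP[/eqP e | lt_in].
  by left; apply: val_inj.
by right; exists (Ordinal lt_in); apply: val_inj.
Qed.

Lemma widen_in_emb F i : (widen_ord (leqnSn n) i \in emb F) = (i \in F).
Proof. by apply: mem_imset => j k /(congr1 val) /= /val_inj. Qed.

Lemma ord_max_notin_emb F : (ord_max \in emb F) = false.
Proof.
apply/imsetP=> -[i _ /(congr1 val) /= e].
by have := ltn_ord i; rewrite -e ltnn.
Qed.

Lemma widen_in_add_last F i :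
  (widen_ord (leqnSn n) i \in add_last F) = (i \in F).
Proof.
rewrite in_setU1 widen_in_emb; case: eqP => // /(congr1 val) /= e.
by have := ltn_ord i; rewrite e ltnn.
Qed.

Lemma emb_or_add_last (H : {set 'I_n.+1}) :
  exists F, H = emb F \/ H = add_last F.
Proof.
exists [set i | widen_ord (leqnSn n) i \in H].
case: (boolP (ord_max \in H)) => mH; [right | left]; apply/setP=> i;
  case: (ord_maxVwiden i) => [-> | [j ->]].
- by rewrite setU11.
- by rewrite widen_in_add_last inE.
- by rewrite ord_max_notin_emb (negbTE mH).
- by rewrite widen_in_emb inE.
Qed.

Lemma emb_subset F G : (emb F \subset emb G) = (F \subset G).
Proof.
apply/idP/idP => [/subsetP s | ]; last exact: imsetS.
by apply/subsetP=> i; rewrite -!widen_in_emb => /s.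
Qed.

Lemma add_last_subset F G : (add_last F \subset add_last G) = (F \subset G).
Proof.
apply/idP/idP => [/subsetP s | s]; last by rewrite setUS // emb_subset.
by apply/subsetP=> i; rewrite -!widen_in_add_last => /s.
Qed.

Lemma emb_subset_add_last F G : (emb F \subset add_last G) = (F \subset G).
Proof.
apply/idP/idP => [/subsetP s | s].
  by apply/subsetP=> i; rewrite -widen_in_emb -widen_in_add_last => /s.
by rewrite (subset_trans _ (subsetUr _ _)) // emb_subset.
Qed.

Lemma add_last_subset_emb F G : (add_last F \subset emb G) = false.
Proof.
apply/negbTE/negP=> /subsetP/(_ ord_max).
by rewrite setU11 ord_max_notin_emb => /(_ isT).
Qed.

(** As a rewrite rule, this turns each inclusion between lifted sets into one in [n-1] or into
    [false]. *)
Definition lift_subset :=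
  (emb_subset, add_last_subset, emb_subset_add_last, add_last_subset_emb).

Lemma delta0_complex D : simplicial_complex D -> simplicial_complex (delta0 D).
Proof. by move=> hD F G; rewrite !inE -emb_subset; apply: hD. Qed.

Lemma delta1_complex D : simplicial_complex D -> simplicial_complex (delta1 D).
Proof. by move=> hD F G; rewrite !inE -add_last_subset; apply: hD. Qed.

(** [P0] and [P1] are arbitrary partitions, so that both (C1) and (C3) are instances. *)
Lemma interval_partition_union D P0 P1 (hD : simplicial_complex D) :
  interval_partition (delta0 D) P0 -> interval_partition (delta1 D) P1 ->
  interval_partition D
    ([set (emb p.1, emb p.2) | p in P0]
       :|: [set (add_last p.1, add_last p.2) | p in P1]).
Proof.
case/(interval_partitionP _ (delta0_complex hD)) => face0 cover0 disj0.
case/(interval_partitionP _ (delta1_complex hD)) => face1 cover1 disj1.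
apply/(interval_partitionP _ hD); split.
- move=> q; case/setUP=> /imsetP[p pP ->] /=; rewrite lift_subset.
    by case: (face0 p pP); rewrite inE.
  by case: (face1 p pP); rewrite inE.
- move=> H; have [F [] -> FD] := emb_or_add_last H.
    have [|p pP pF] := cover0 F; first by rewrite inE.
    exists (emb p.1, emb p.2); last by rewrite /in_span /= !lift_subset.
    by apply/setUP; left; apply/imsetP; exists p.
  have [|p pP pF] := cover1 F; first by rewrite inE.
  exists (add_last p.1, add_last p.2); last by rewrite /in_span /= !lift_subset.
  by apply/setUP; right; apply/imsetP; exists p.
(* An [emb F] lies only in spans lifted from [P0], an [add_last F] only in spans lifted from [P1];
   of the four combinations, one survives for each form of [H]. *)
- move=> p' q' H; have [F [] ->] := emb_or_add_last H;
    case/setUP=> /imsetP[p pP ->]; case/setUP=> /imsetP[q qP ->];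
    rewrite /in_span /= !lift_subset ?andbF //= => pF qF.
    by rewrite (disj0 p q F).
  by rewrite (disj1 p q F).
Qed.

(** Here [D] is a cone with apex [ord_max]: the span from [emb p.1] to [add_last p.2] contains
    [emb F], and likewise [add_last F], exactly when [p] spans [F]. *)
Lemma interval_partition_cone D P0 (hD : simplicial_complex D) :
  delta0 D = delta1 D -> interval_partition (delta0 D) P0 ->
  interval_partition D [set (emb p.1, add_last p.2) | p in P0].
Proof.
move=> e /(interval_partitionP _ (delta0_complex hD))[face0 cover0 disj0].
apply/(interval_partitionP _ hD); split.
- move=> _ /imsetP[p pP ->] /=; rewrite lift_subset.
  by case: (face0 p pP); rewrite e inE.
- move=> H; have [F eH] := emb_or_add_last H => HD.
  have FD : F \in delta0 D by case: eH HD => -> ?; [|rewrite e]; rewrite inE.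
  have [p pP pF] := cover0 F FD.
  exists (emb p.1, add_last p.2); first by apply/imsetP; exists p.
  by case: eH => ->; rewrite /in_span /= !lift_subset.
- move=> p' q' H; have [F [] ->] := emb_or_add_last H;
    move=> /imsetP[p pP ->] /imsetP[q qP ->]; rewrite /in_span /= !lift_subset;
    by move=> pF qF; rewrite (disj0 p q F).
Qed.

End Lifting.

Lemma interval_partition_setT (n : nat) :
  interval_partition [set: {set 'I_n}] [set (set0, setT)].
Proof.
apply/interval_partitionP=> [F G _ _ | ]; first by rewrite inE.
split=> [p /set1P-> | H _ | p q H /set1P-> /set1P->] //.
  by rewrite inE sub0set.
by exists (set0, setT); rewrite ?set11 // /in_span sub0set subsetT.
Qed.

Lemma set_ord1P (F : {set 'I_1}) : F = set0 \/ F = [set ord0].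
Proof.
case: (boolP (ord0 \in F)) => F0; [right | left]; apply/setP=> i;
  by rewrite (ord1 i) !inE ?F0 ?(negbTE F0).
Qed.

Lemma janet_base_partition (D : {set {set 'I_1}}) :
  simplicial_complex D -> interval_partition D (janet_base D).
Proof.
move=> hD; apply/(interval_partitionP _ hD); rewrite /janet_base.
case: eqP => [-> | nD1].
  split=> [p /set1P-> | H HD | p q H /set1P-> /set1P->] //=.
    by rewrite !inE eqxx orbT sub0set.
  exists (set0, [set ord0]); rewrite ?set11 // /in_span sub0set /=.
  by case: (set_ord1P H) => ->; rewrite ?sub0set.
case: eqP => [-> | nD0].
  split=> [p /set1P-> | H /set1P-> | p q H /set1P-> /set1P->] //=.
    by rewrite set11.
  by exists (set0, set0); rewrite ?set11 // /in_span /= subxx.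
(* If [set0] were a face, [D] would be one of the two excluded families, according to whether
   [[set ord0]] is a face. Hence [D] is empty by downward closure. *)
have D0 : set0 \notin D.
  apply/negP=> D0; case: (boolP ([set ord0] \in D)) => D1; [apply: nD1 | apply: nD0];
    apply/setP=> F; case: (set_ord1P F) => ->;
    rewrite !inE ?D0 ?D1 ?(negbTE D1) ?eqxx ?orbT //.
  by apply/esym/eqP=> /setP/(_ ord0); rewrite !inE.
split=> [p | H /hD/(_ (sub0set H)) | p q H]; rewrite ?inE //.
by rewrite (negbTE D0).
Qed.

Lemma janet_step_partition (n : nat) rec (D : {set {set 'I_n.+1}}) :
  (forall E : {set {set 'I_n}}, simplicial_complex E ->
     interval_partition E (rec E)) ->
  simplicial_complex D -> interval_partition D (janet_step rec D).
Proof.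
move=> recP hD; have rec0 := recP _ (delta0_complex hD).
have rec1 := recP _ (delta1_complex hD).
rewrite /janet_step; case: eqP => [e | _]; first exact: interval_partition_cone.
case: eqP => [e | _]; last exact: interval_partition_union.
(* In (C3) this partition replaces [rec (delta0 D)]. *)
have full0 : interval_partition (delta0 D) [set (set0, setT)].
  by rewrite e; apply: interval_partition_setT.
have := interval_partition_union hD full0 rec1.
(* The lifted pair is [(emb set0, emb setT)]; its lower end is [set0], as in the algorithm. *)
by rewrite imset_set1 /= {1}/emb imset0.
Qed.

Theorem lemma3p1 (n : nat) (hn : 1 <= n) (D : {set {set 'I_n}})
    (hD : simplicial_complex D) :
  interval_partition D (janet D).
Proof.
(* The induction runs on the predecessor of the number of vertices, so its base is [1] and the dummy
   value at 0 is never reached. *)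
case: n hn D hD => // n _; elim: n => [|n IHn] D hD.
  exact: janet_base_partition.
exact: (janet_step_partition (rec := @janet n.+1)).
Qed.
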